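(* Fix integers $d,m,n\geq 2$, a proper divisor $\ell\geq1$ of $n$, and a $d$-th root of unity $\zeta\neq1$. Define $C_{d,m,\ell}=d^{\ell}\big(\prod_{i=0}^{\ell-1}a_{m-1+i}\big)^{d-1}\in\mathbb{Z}[c]$. Then for every integer $j\geq1$, $$b_{j+1}\equiv \zeta^{d-1}C_{d,m,\ell}\,b_j+1\pmod{I},$$ where $I=\langle B_1\rangle$ is the principal ideal of $\mathbb{Z}[\zeta,c]$ generated by $B_1=a_{m+\ell-1}-\zeta a_{m-1}$. In particular, for any root $\alpha_0$ of $B_1$, $b_{j+1}(\alpha_0)=\zeta^{d-1}C_{d,m,\ell}(\alpha_0)b_j(\alpha_0)+1$.
   Context: For an integer $d\geq 2$ define polynomials $a_i\in\mathbb{Z}[c]$ by $a_1=c$, $a_{i+1}=a_i^d+c$, with $a_0=0$. For the fixed $m,\ell,\zeta$, set $B_j=a_{m+\ell j-1}-\zeta a_{m-1}\in\mathbb{Z}[\zeta,c]$ for $j\geq1$ and $b_j=B_j/B_1$; each $b_j$ is a polynomial in $\mathbb{Z}[\zeta,c]$. *)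

(* Defs.v *)
From HB Require Import structures.
From mathcomp Require Import all_boot all_order all_algebra.

Set Implicit Arguments.
Unset Strict Implicit.
Unset Printing Implicit Defensive.

Import GRing.Theory Num.Theory.
Local Open Scope ring_scope.

(* The variable 'X of the univariate polynomials below is the parameter c. *)

Fixpoint apoly (d i : nat) : {poly int} :=
  if i is k.+1 then apoly d k ^+ d + 'X else 0.

Definition Cpoly (d m l : nat) : {poly int} :=
  (d%:R ^+ l) * (\prod_(i < l) apoly d (m - 1 + i)) ^+ (d - 1).

Section OverC.
Variable C : numClosedFieldType.

Definition toC (p : {poly int}) : {poly C} := map_poly intr p.

(* Z[z,c], viewed inside C[c], is the image of Z[t][c] under t |-> z. *)
Definition evalZ (z : C) (P : {poly {poly int}}) : {poly C} :=
  map_poly (horner_eval z \o map_poly intr) P.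

Definition in_Zzc (z : C) (p : {poly C}) : Prop := exists P, p = evalZ z P.

(* Congruence of p and q modulo the principal ideal of Z[z,c] generated
   by g; the cofactor is required to lie in Z[z,c], not merely in C[c]. *)
Definition congr_Zzc (z : C) (g p q : {poly C}) : Prop :=
  exists2 r, in_Zzc z r & p - q = r * g.

Definition Bpoly (d m l : nat) (z : C) (j : nat) : {poly C} :=
  toC (apoly d (m + l * j - 1)) - z *: toC (apoly d (m - 1)).

(* The quotient is taken in C[c]. It is exact (bpolyK) and it lies in
   Z[z,c] (bpoly_in_Zzc). *)
Definition bpoly (d m l : nat) (z : C) (j : nat) : {poly C} :=
  Bpoly d m l z j %/ Bpoly d m l z 1.

Section Facts.
Variables (d m l : nat) (z : C).
Hypotheses (d_ge2 : (2 <= d)%N) (m_ge2 : (2 <= m)%N) (l_ge1 : (1 <= l)%N).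
Hypotheses (zd1 : z ^+ d = 1) (z_neq1 : z != 1).

Let B := Bpoly d m l z.

Lemma toC_aS i : toC (apoly d i.+1) = toC (apoly d i) ^+ d + 'X.
Proof. by rewrite /toC /= rmorphD rmorphXn /= map_polyX. Qed.

Lemma coef_apoly i : (apoly d i)`_0 = 0 /\ (apoly d i.+1)`_1 = 1.
Proof.
have e0 k : (apoly d k)`_0 = 0.
  elim: k => [|k IH]; first by rewrite coef0.
  rewrite /= coefD coefX addr0 -horner_coef0 horner_exp horner_coef0 IH.
  by rewrite expr0n; case: (d) d_ge2.
split=> //=; rewrite coefD coefX.
have /eqP/(@factor_theorem _ (apoly d i) 0) [q ->] : (apoly d i).[0] = 0.
  by rewrite horner_coef0.
rewrite subr0 exprMn -(subnK d_ge2) [('X) ^+ _]exprD mulrA coefMXn /=.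
by rewrite add0r.
Qed.

Lemma Bpoly1_neq0 : B 1 != 0.
Proof.
apply/eqP=> /(congr1 (fun p : {poly C} => p`_1)).
rewrite /B /Bpoly muln1 coef0 coefB coefZ !coef_map /=.
have -> : (m + l - 1 = (m + l - 2).+1)%N by rewrite -!subSn // ltn_addr.
have -> : (m - 1 = (m - 2).+1)%N by rewrite -subSn.
rewrite !(proj2 (coef_apoly _)) mulr1 => /eqP.
by rewrite subr_eq0 eq_sym (negPf z_neq1).
Qed.

Lemma in_Zzc_evalZ P : in_Zzc z (evalZ z P). Proof. by exists P. Qed.

Lemma in_Zzc_toC p : in_Zzc z (toC p).
Proof.
exists (map_poly polyC p); rewrite /evalZ /toC -map_poly_comp.
apply: eq_map_poly => x /=.
by rewrite map_polyC /= /horner_eval hornerC.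
Qed.

Lemma in_ZzcZ p : in_Zzc z p -> in_Zzc z (z *: p).
Proof.
move=> [P ->]; exists ('X *: P); rewrite /evalZ map_polyZ /=.
by rewrite map_polyX /horner_eval hornerX.
Qed.

Lemma in_ZzcB p q : in_Zzc z p -> in_Zzc z q -> in_Zzc z (p - q).
Proof. by move=> [P ->] [Q ->]; exists (P - Q); rewrite /evalZ rmorphB. Qed.

Lemma in_ZzcM p q : in_Zzc z p -> in_Zzc z q -> in_Zzc z (p * q).
Proof. by move=> [P ->] [Q ->]; exists (P * Q); rewrite /evalZ rmorphM. Qed.

Lemma in_ZzcD p q : in_Zzc z p -> in_Zzc z q -> in_Zzc z (p + q).
Proof. by move=> [P ->] [Q ->]; exists (P + Q); rewrite /evalZ rmorphD. Qed.

Lemma in_ZzcX p k : in_Zzc z p -> in_Zzc z (p ^+ k).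
Proof. by move=> [P ->]; exists (P ^+ k); rewrite /evalZ rmorphXn. Qed.

Lemma congr_ZzcXn g p q k : in_Zzc z p -> in_Zzc z q ->
  congr_Zzc z g p q -> congr_Zzc z g (p ^+ k) (q ^+ k).
Proof.
move=> Zp Zq [r Zr e].
elim: k => [|k [s Zs IH]].
  by exists (toC 0); [exact: in_Zzc_toC | rewrite /toC rmorph0 mul0r subrr].
exists (r * p ^+ k + q * s).
  by apply: in_ZzcD; apply: in_ZzcM => //; apply: in_ZzcX.
rewrite mulrDl mulrAC -e -[q * s * g]mulrA -IH !exprS mulrBl mulrBr.
by rewrite addrA subrK.
Qed.

Lemma congr_Zzc_trans g p q r :
  congr_Zzc z g p q -> congr_Zzc z g q r -> congr_Zzc z g p r.
Proof.
move=> [s Zs e] [t Zt f]; exists (s + t); first exact: in_ZzcD.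
by rewrite mulrDl -e -f addrA subrK.
Qed.

Lemma congr_orbit k :
  congr_Zzc z (B 1) (toC (apoly d (m + l + k))) (toC (apoly d (m + k))).
Proof.
elim: k => [|k [r Zr e]]; last first.
  rewrite !addnS !toC_aS.
  have [s Zs f] : congr_Zzc z (B 1) (toC (apoly d (m + l + k)) ^+ d)
      (toC (apoly d (m + k)) ^+ d).
    by apply: congr_ZzcXn; [exact: in_Zzc_toC | exact: in_Zzc_toC | exists r].
  by exists s => //; rewrite opprD addrACA subrr addr0.
rewrite !addn0.
have -> : (m + l = (m + l - 1).+1)%N by rewrite subn1 prednK // addn_gt0 ltnW.
have -> : (apoly d m = apoly d (m - 1).+1) by rewrite subn1 prednK // ltnW.
rewrite !toC_aS.
have [||| s Zs f] := @congr_ZzcXn (B 1) (toC (apoly d (m + l - 1)))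
  (z *: toC (apoly d (m - 1))) d.
- exact: in_Zzc_toC.
- by apply: in_ZzcZ; apply: in_Zzc_toC.
- exists (toC 1); first exact: in_Zzc_toC.
  by rewrite /B /Bpoly muln1 /toC rmorph1 mul1r.
exists s => //; rewrite -f exprZn zd1 scale1r.
by rewrite opprD addrACA subrr addr0.
Qed.

Lemma Bpoly_multiple j : (1 <= j)%N ->
  exists2 q, in_Zzc z q & B j = q * B 1.
Proof.
case: j => // j _; elim: j => [|j [q Zq e]].
  by exists (toC 1); [exact: in_Zzc_toC | rewrite /toC rmorph1 mul1r].
have [r Zr f] := congr_orbit (l * j.+1 - 1).
have g : (0 < l * j.+1)%N by rewrite muln_gt0 l_ge1.
exists (r + q); first exact: in_ZzcD.
rewrite mulrDl -e -f /B /Bpoly !addnBA //.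
by rewrite [(l * j.+2)%N]mulnS addnA addrA subrK.
Qed.

Lemma bpolyK j : (1 <= j)%N -> bpoly d m l z j * B 1 = B j.
Proof.
case/Bpoly_multiple=> q _; rewrite /bpoly -/(B _) => ->.
by rewrite mulpK // Bpoly1_neq0.
Qed.

Lemma bpoly_in_Zzc j : (1 <= j)%N -> in_Zzc z (bpoly d m l z j).
Proof.
case/Bpoly_multiple=> q Zq; rewrite /bpoly -/(B _) => ->.
by rewrite mulpK // Bpoly1_neq0.
Qed.

End Facts.
End OverC.

(* Main.v *)
(** Since [B_(j+1) - B_1 = a_(m+l+lj-1) - a_(m+l-1)], it suffices to follow the
    difference [a_(m+lj-1+k) - a_(m-1+k)] up to [k = l]. Raising to the power [d]
    is linear modulo [B_1 ^+ 2] on differences that are multiples of [B_1]: the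
    first step starts from [a_(m+lj-1) = z a_(m-1) + B_j] and contributes
    [d (z a_(m-1)) ^+ (d - 1)], and each later one contributes
    [d a_(m-1+k) ^+ (d - 1)]. Hence
    [B_(j+1) = z ^+ (d - 1) C B_j + B_1] modulo [B_1 ^+ 2]; divide by [B_1]. *)

Require Import Defs.
From HB Require Import structures.
From mathcomp Require Import all_boot all_order all_algebra.
From mathcomp Require Import ring.

Import GRing.Theory Num.Theory.
Local Open Scope ring_scope.

(** Stated over any commutative ring so that it can be used in [{poly {poly int}}], before [t] is
    specialised to [z]. *)
Lemma exprD_taylor2 (R : comPzRingType) (x u : R) (k : nat) :
  exists s, (x + u) ^+ k.+1 = x ^+ k.+1 + k.+1%:R * x ^+ k * u + s * u ^+ 2.
Proof.
elim: k => [|k [s IH]].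
  by exists 0; rewrite !expr1 expr0 mulr1 mul1r mul0r addr0.
exists (k.+1%:R * x ^+ k + s * (x + u)).
by rewrite exprSr IH -[k.+2%:R]natr1 !exprS expr0; ring.
Qed.

Section Congruences.
Variables (C : numClosedFieldType) (z : C).
Implicit Types g p q r t x y : {poly C}.

(** Expanding the preimages of [x] and [u] and then applying the ring morphism [evalZ z] keeps the
    cofactor in Z[z,c]. *)
Lemma in_Zzc_taylor x u k : in_Zzc z x -> in_Zzc z u ->
  exists2 s, in_Zzc z s &
    (x + u) ^+ k.+1 = x ^+ k.+1 + k.+1%:R * x ^+ k * u + s * u ^+ 2.
Proof.
move=> [X ->] [U ->]; have [S e] := exprD_taylor2 _ X U k.
exists (evalZ z S); first exact: in_Zzc_evalZ.
have /(congr1 (evalZ z)) := e.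
by rewrite /evalZ !(rmorphD, rmorphM, rmorphXn, rmorph_nat).
Qed.

Lemma in_ZzcZX p k : in_Zzc z p -> in_Zzc z (z ^+ k *: p).
Proof.
move=> Zp; elim: k => [|k IH]; first by rewrite expr0 scale1r.
by rewrite exprS -scalerA; apply: in_ZzcZ.
Qed.

Lemma congr_ZzcMl g p q r : in_Zzc z r ->
  congr_Zzc z g p q -> congr_Zzc z g (r * p) (r * q).
Proof.
move=> Zr [s Zs e]; exists (r * s); first exact: in_ZzcM.
by rewrite -mulrBr e mulrA.
Qed.

(** With [x = y + t * g], the second-order remainder [s * (t * g) ^+ 2] is a multiple of
    [g ^+ 2]. *)
Lemma congr_Zzc_exprB g x y t k : in_Zzc z y -> in_Zzc z t -> in_Zzc z g ->
    x - y = t * g ->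
  congr_Zzc z (g ^+ 2) (x ^+ k.+1 - y ^+ k.+1) (k.+1%:R * y ^+ k * (x - y)).
Proof.
move=> Zy Zt Zg e; have [s Zs f] := @in_Zzc_taylor y (t * g) k Zy (in_ZzcM Zt Zg).
exists (s * t ^+ 2); first by apply: in_ZzcM => //; apply: in_ZzcX.
have -> : x = y + t * g by rewrite -e; ring.
by rewrite f; ring.
Qed.

Lemma congr_Zzc_root g p q a :
  congr_Zzc z g p q -> root g a -> p.[a] = q.[a].
Proof.
case=> r _ e /eqP ga; apply/eqP; rewrite -subr_eq0 -hornerN -hornerD e.
by rewrite hornerM ga mulr0.
Qed.

End Congruences.

(** One more step of the orbit contributes one more derivative of [x ^+ d], as in the chain rule. *)
Lemma CpolyS (d m k : nat) :
  Cpoly d m k.+1 = d%:R * apoly d (m - 1 + k) ^+ (d - 1) * Cpoly d m k.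
Proof. by rewrite /Cpoly big_ord_recr /= exprMn exprS; ring. Qed.

Section Orbit.
Variables (C : numClosedFieldType) (d m l : nat) (z : C).
Hypotheses (d_ge2 : (2 <= d)%N) (m_ge2 : (2 <= m)%N) (l_ge1 : (1 <= l)%N).
Hypotheses (zd1 : z ^+ d = 1) (z_neq1 : z != 1).

Let B := Bpoly d m l z.
Let b := bpoly d m l z.
Let a i := toC C (apoly d i).

Let aS i : a i.+1 = a i ^+ d + 'X. Proof. exact: toC_aS. Qed.

Let in_Zzc_a i : in_Zzc z (a i). Proof. exact: in_Zzc_toC. Qed.

Lemma in_Zzc_Bpoly j : in_Zzc z (B j).
Proof. exact: in_ZzcB (in_Zzc_a _) (in_ZzcZ (in_Zzc_a _)). Qed.

Lemma congr_orbit_sqr j k : (1 <= j)%N ->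
  congr_Zzc z (B 1 ^+ 2) (a (m + l * j - 1 + k.+1) - a (m - 1 + k.+1))
    (z ^+ (d - 1) *: (toC C (Cpoly d m k.+1) * B j)).
Proof.
move=> j_ge1; have Zb : in_Zzc z (b j) by exact: bpoly_in_Zzc.
have bK : b j * B 1 = B j by exact: bpolyK.
have dE : d = (d - 1).+1 by rewrite subn1 prednK // ltnW.
have toCS i : toC C (Cpoly d m i.+1) =
    d%:R * a (m - 1 + i) ^+ (d - 1) * toC C (Cpoly d m i).
  by rewrite CpolyS /toC !(rmorphM, rmorphXn, rmorph_nat).
have step x y t : in_Zzc z y -> in_Zzc z t -> x - y = t * B 1 ->
    congr_Zzc z (B 1 ^+ 2) (x ^+ d - y ^+ d) (d%:R * y ^+ (d - 1) * (x - y)).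
  move=> Zy Zt /(congr_Zzc_exprB _ _ (B 1) x y t (d - 1)%N Zy Zt (in_Zzc_Bpoly 1)).
  by rewrite -dE.
elim: k => [|k IH].
  rewrite !addn1 !aS toCS addn0.
  (* The comparison point is [z *: a (m - 1)]: its [d]-th power loses [z] since [z ^+ d = 1], while
     the derivative there leaves the factor [z ^+ (d - 1)]. *)
  have e : a (m + l * j - 1) - z *: a (m - 1) = b j * B 1 by rewrite bK.
  have [r Zr f] := step _ _ _ (in_ZzcZ (in_Zzc_a _)) Zb e.
  exists r => //; rewrite -f e bK !exprZn zd1 scale1r.
  rewrite /Cpoly expr0 big_ord0 expr1n mulr1 /toC rmorph1 mulr1.
  by rewrite -scalerAr -scalerAl; ring.
have [r Zr f] := IH.
(* Both the remainder and the main term of [IH] are multiples of [B 1], so [step] applies again. *)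
have [t Zt e] : exists2 t, in_Zzc z t &
    a (m + l * j - 1 + k.+1) - a (m - 1 + k.+1) = t * B 1.
  exists (r * B 1 + z ^+ (d - 1) *: (toC C (Cpoly d m k.+1) * b j)).
    apply: in_ZzcD; first by apply: in_ZzcM => //; apply: in_Zzc_Bpoly.
    by apply: in_ZzcZX; apply: in_ZzcM => //; apply: in_Zzc_toC.
  rewrite mulrDl -scalerAl -[_ * b j * _]mulrA bK -mulrA -expr2 -f.
  by rewrite subrK.
rewrite ![(_ + k.+2)%N]addnS !aS toCS.
have Zc : in_Zzc z (d%:R * a (m - 1 + k.+1) ^+ (d - 1)).
  by rewrite -(rmorph_nat (map_poly intr)) -rmorphXn -rmorphM; apply: in_Zzc_toC.
have [s Zs h] : congr_Zzc z (B 1 ^+ 2) _ _ :=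
  congr_Zzc_trans (step _ _ _ (in_Zzc_a _) Zt e) (congr_ZzcMl _ _ _ _ _ _ Zc IH).
by exists s => //; rewrite -h -scalerAr -[_ * toC C _ * B j]mulrA; ring.
Qed.

Lemma bpoly_rec j : (1 <= j)%N ->
  congr_Zzc z (B 1) (b j.+1)
    (z ^+ (d - 1) *: (toC C (Cpoly d m l) * b j) + 1).
Proof.
move=> j_ge1; have [r Zr e] := congr_orbit_sqr j l.-1 j_ge1.
have B1_neq0 : B 1 != 0 by exact: Bpoly1_neq0.
(* Cancelling one factor [B 1] from the congruence modulo [B 1 ^+ 2] leaves the same cofactor
   [r]. *)
exists r => //; apply: (mulIf B1_neq0).
rewrite mulrBl mulrDl mul1r -scalerAl -[_ * b j * _]mulrA -mulrA -expr2 -e.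
rewrite /b !bpolyK // prednK //.
have -> : (m + l * j - 1 + l = m + l * j.+1 - 1)%N.
  by rewrite mulnS addnC addnBA ?addn_gt0 ?(ltnW m_ge2) // addnCA.
have -> : (m - 1 + l = m + l * 1 - 1)%N.
  by rewrite muln1 addnC addnBA ?(ltnW m_ge2) // addnC.
(* The terms [z *: a (m - 1)] cancel; [B 1] becomes the summand 1 after division. *)
have -> : a (m + l * j.+1 - 1) - a (m + l * 1 - 1) = B j.+1 - B 1.
  by rewrite /B /Bpoly opprB addrA subrK.
by rewrite opprD addrA addrAC.
Qed.

End Orbit.

Theorem theorem4p1 (C : numClosedFieldType) (d m n l : nat) (z : C)
    (hd : (2 <= d)%N) (hm : (2 <= m)%N) (hn : (2 <= n)%N)
    (hl : (1 <= l)%N) (hln : (l %| n)%N) (hlt : (l < n)%N)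
    (hz : z ^+ d = 1) (hz1 : z <> 1) :
  (forall j : nat, (1 <= j)%N ->
     congr_Zzc z (Bpoly d m l z 1)
       (bpoly d m l z j.+1)
       (z ^+ (d - 1) *: (toC C (Cpoly d m l) * bpoly d m l z j) + 1))
  /\
  (forall j : nat, (1 <= j)%N ->
   forall alpha0 : C, root (Bpoly d m l z 1) alpha0 ->
     (bpoly d m l z j.+1).[alpha0] =
       z ^+ (d - 1) * (toC C (Cpoly d m l)).[alpha0]
         * (bpoly d m l z j).[alpha0] + 1).
Proof.
move/eqP: hz1 => z_neq1.
have rec j := @bpoly_rec C d m l z hd hm hl hz z_neq1 j.
split=> // j j_ge1 alpha0 /(congr_Zzc_root _ _ _ _ _ _ (rec j j_ge1)) ->.
by rewrite hornerD hornerZ hornerM hornerC mulrA.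
Qed.
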